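(* Let $X$ be a nonempty compact metrizable space and let $f:X\to X$ be an arbitrary map (no continuity or other regularity is assumed). Then $(X,f)$ has a $\mathcal{C}$-transitive subsystem; that is, there exists a nonempty closed set $Y\subseteq X$ with $f(Y)\subseteq Y$ such that the system $(Y,f|_Y)$ is chain-transitive, i.e. for every $x,y\in Y$ and every $\epsilon>0$ there exists an $\epsilon$-chain from $x$ to $y$ all of whose points belong to $Y$.
   Context: A compact dynamical system is a pair $(X,f)$ with $X$ a compact metrizable space and $f:X\to X$ an arbitrary self-map. Fix a metric $d$ compatible with the topology of $X$. For $x,y\in X$ and $\epsilon>0$, an $\epsilon$-chain from $x$ to $y$ is a finite sequence $x_0,x_1,\dots,x_n$ of points of $X$, with $n\ge 1$, such that $x_0=x$, $x_n=y$ and $d(f(x_i),x_{i+1})<\epsilon$ for every $i=0,\dots,n-1$. The chain relation is defined by: $x\,\mathcal{C}\,y$ iff for every $\epsilon>0$ there exists an $\epsilon$-chain from $x$ to $y$. (Since $X$ is compact, these notions do not depend on the choice of the compatible metric $d$.) For $Y\subseteq X$, $(Y,f|_Y)$ is a subsystem of $(X,f)$ if $Y$ is closed and invariant, i.e. $f(Y)\subseteq Y$. A subset $M$ of a system is $\mathcal{C}$-transitive (chain-transitive) if $x\,\mathcal{C}\,y$ for all $x,y\in M$; a subsystem $(Y,f|_Y)$ is chain-transitive if $Y$ is chain-transitive with respect to the system $(Y,f|_Y)$ itself, so that the chains are required to consist of points of $Y$. *)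

(* Defs.v *)
From mathcomp Require Import all_boot all_order all_algebra.
From mathcomp Require Import all_classical all_reals topology.
Set Implicit Arguments.
Unset Strict Implicit.
Unset Printing Implicit Defensive.
Local Open Scope classical_set_scope.
Local Open Scope ring_scope.

(* The system (Y, f|_Y) is represented by a set Y together with the ambient
   map f; taking Y := [set: X] gives the notions for (X, f) itself. *)

(* x :: p is the chain x_0, x_1, ..., x_n with x_0 = x, so that n = size p. *)
Definition is_chain (R : realType) (X : metricType R) (f : X -> X) (Y : set X)
    (e : R) (x y : X) (p : seq X) : Prop :=
  [/\ (1 <= size p)%N,
      last x p = y,
      (forall z, z \in x :: p -> Y z) &
      path (fun a b => mdist (f a) b < e) x p].

Definition chain_rel (R : realType) (X : metricType R) (f : X -> X) (Y : set X)
    (x y : X) : Prop :=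
  forall e : R, 0 < e -> exists p : seq X, is_chain f Y e x y p.

Definition chain_transitive (R : realType) (X : metricType R) (f : X -> X)
    (Y M : set X) : Prop :=
  forall x y : X, M x -> M y -> chain_rel f Y x y.

Definition subsystem (X : topologicalType) (f : X -> X) (Y : set X) : Prop :=
  closed Y /\ f @` Y `<=` Y.

(* The chains are required to stay in Y, not merely in X. *)
Definition chain_transitive_subsystem (R : realType) (X : metricType R)
    (f : X -> X) (Y : set X) : Prop :=
  subsystem f Y /\ chain_transitive f Y Y.

(* Main.v *)
(** By compactness and Zorn's lemma there is a minimal nonempty closed
    invariant set [Y].  For [x] in [Y], the set of points of [Y] reachable from
    [x] by [e]-chains in [Y] for every [e] is closed, because only the endpoint
    of a chain has to be moved to approximate a limit point; it is invariant
    and contains [f x], because the step from [z] to [f z] has error [0].  No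
    continuity of [f] enters.  By minimality this set is [Y]. *)
Require Import Defs.
From mathcomp Require Import all_boot all_order all_algebra.
From mathcomp Require Import all_classical all_reals topology.
Import Order.TTheory GRing.Theory Num.Theory.
Local Open Scope classical_set_scope.
Local Open Scope ring_scope.

Lemma exists_minimal_subsystem (X : topologicalType) (f : X -> X) :
    [set: X] !=set0 -> compact [set: X] ->
  exists Y : set X, [/\ Y !=set0, subsystem f Y &
    forall Z, Z `<=` Y -> Z !=set0 -> subsystem f Z -> Z = Y].
Proof.
move=> X0 cX.
pose P (U : set X) := ~` U !=set0 /\ subsystem f (~` U).
have [F FP totF|U [[U0 sU] Umax]] := @Zorn_bigcup X P; last first.
  exists (~` U); split=> // Z ZU Z0 sZ.
  apply: contrapT => neZU; apply: (Umax (~` Z)); last by rewrite /P setCK.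
  split; first exact: subsetCr.
  by move=> /subsetCl UZ; apply: neZU; apply/seteqP.
have bigcl : closed (\bigcap_(U in F) ~` U).
  by apply: closed_bigI => U /FP[_ []].
rewrite /P setC_bigcup; split; last first.
  split=> // _ [z zF <-] U FU.
  by have [_ [_]] := FP _ FU; apply; exists z => //; exact: zF.
(* For the empty chain the intersection is all of [X], which is nonempty by hypothesis. *)
have [[U0 FU0]|F0] := pselect (F !=set0); last first.
  have [x _] := X0; exists x => U FU.
  by case: F0; exists U.
(* Totality of the chain makes the complements a filter base. Being closed, each of them contains
   every cluster point of that filter, and compactness supplies one. *)
have proper : ProperFilter (filter_from F (@setC X)).
  apply: filter_from_proper => [|U /FP[]//].
  apply: filter_from_filter; first by exists U0.
  move=> U V FU FV; have [UV|VU] := totF _ _ FU FV.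
  - by exists V => // z zV; split=> //; apply: contra_not zV; exact: UV.
  - by exists U => // z zU; split=> //; apply: contra_not zU; exact: VU.
have [|x [_ xF]] := cX _ proper; first by exists U0.
exists x => U FU; have [_ [clU _]] := FP _ FU.
by apply: clU => B; apply: xF; exists U.
Qed.

Section ChainClass.
Context (R : realType) (X : metricType R) (f : X -> X) (Y : set X).

Definition chain_class (x : X) : set X := [set y | Y y /\ chain_rel f Y x y].

(** A chain has at least one step, and [f] is not applied at its last position, so replacing the
    last point affects a single inequality, which the triangle inequality through [v] repairs. *)
Lemma is_chain_move_endpoint (e d : R) (x v w : X) (p : seq X) :
  Y w -> mdist v w < d -> is_chain f Y e x v p ->
  exists q, is_chain f Y (e + d) x w q.
Proof.
move=> Yw vw [+ + + +]; case: (lastP p) => // {}p z _.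
rewrite last_rcons => -> pY; rewrite rcons_path => /andP[pp lastp].
(* This lets the untouched steps pass from the bound [e] to [e + d]. *)
have d0 : 0 <= d by rewrite (le_trans (mdist_ge0 v w))// ltW.
exists (rcons p w); split; rewrite ?size_rcons ?last_rcons//.
  move=> u; rewrite inE mem_rcons inE => /or3P[/eqP->|/eqP->//|up].
  - by apply: pY; rewrite mem_head.
  - by apply: pY; rewrite inE mem_rcons inE up !orbT.
rewrite rcons_path; apply/andP; split.
  by apply: sub_path pp => a b ab; rewrite ltr_wpDr.
by rewrite (le_lt_trans (metric_triangle _ v _))// ltrD.
Qed.

Lemma chain_rel_step (x : X) : Y x -> Y (f x) -> chain_rel f Y x (f x).
Proof.
move=> Yx Yfx e e0; exists [:: f x]; split => //=.
  by move=> z; rewrite !inE => /orP[]/eqP->.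
by rewrite mdistxx e0.
Qed.

Lemma chain_rel_trans (x y z : X) :
  chain_rel f Y x y -> chain_rel f Y y z -> chain_rel f Y x z.
Proof.
move=> xy yz e e0.
have [p [p0 py pY pp]] := xy e e0; have [q [q0 qz qY qp]] := yz e e0.
exists (p ++ q); split.
- by rewrite size_cat ltn_addr.
- by rewrite last_cat py.
- move=> u; rewrite -cat_cons mem_cat => /orP[/pY//|uq].
  by apply: qY; rewrite inE uq orbT.
- by rewrite cat_path py pp.
Qed.

Lemma closed_chain_class (x : X) : closed Y -> closed (chain_class x).
Proof.
move=> clY y cly; have Yy : Y y.
  by apply: clY; apply: closure_subset cly => z [].
split=> // e e0; have e20 : 0 < e / 2 by rewrite divr_gt0.
(* Half of [e] is spent on the chain to [v], the other half on moving its endpoint from [v] to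
   [y]. *)
have [v [[_ xv] yv]] := cly _ (nbhsx_ballx y (e / 2) e20).
have [p xvp] := xv _ e20.
rewrite [e]splitr; apply: is_chain_move_endpoint xvp => //.
by move: yv; rewrite ballEmdist/= metric_sym.
Qed.

Lemma subsystem_chain_class (x : X) :
  subsystem f Y -> subsystem f (chain_class x).
Proof.
move=> [clY fY]; split; first exact: closed_chain_class.
move=> _ [y [Yy xy] <-]; have Yfy : Y (f y) by apply: fY; exists y.
by split=> //; apply: chain_rel_trans xy _; exact: chain_rel_step.
Qed.

Lemma minimal_subsystem_chain_transitive :
  subsystem f Y ->
  (forall Z, Z `<=` Y -> Z !=set0 -> subsystem f Z -> Z = Y) ->
  chain_transitive f Y Y.
Proof.
move=> sY Ymin x y Yx; rewrite -[in Y y](Ymin (chain_class x)).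
- by case.
- by move=> z [].
(* The witness of nonemptiness is [f x] rather than [x]: chains have at least one step, so [x] is
   not yet known to lie in its own class. *)
- have Yfx : Y (f x) by apply: sY.2; exists x.
  by exists (f x); split=> //; exact: chain_rel_step.
- exact: subsystem_chain_class.
Qed.

End ChainClass.

Theorem theorem3p9 (R : realType) (X : metricType R) (f : X -> X)
    (X_nonempty : [set: X] !=set0) (X_compact : compact [set: X]) :
  exists Y : set X, Y !=set0 /\ chain_transitive_subsystem f Y.
Proof.
have [Y [Y0 sY Ymin]] := exists_minimal_subsystem _ f X_nonempty X_compact.
exists Y; split=> //; split=> //.
exact: minimal_subsystem_chain_transitive.
Qed.
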